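(* Let $a\in\mathbb C$, $N\ge5$ ($N=2n$ or $2n+1$), $\mathfrak g_N=\mathfrak{so}_N$, $q=2$, $p=N-2$, and $d=N/4-1$. Then the matrix $$K(u;a)=k(u)\left(I-\frac{2u}{u-a}E_{-n,-n}-\frac{2u}{u+a-2d}E_{nn}\right),\qquad k(u)=\frac{(u-a)(u+a-2d)}{(u-d)^2},$$ is a one-parameter solution of the reflection equation $$R(u-v)\,K_1(u;a)\,R(u+v)\,K_2(v;a)=K_2(v;a)\,R(u+v)\,K_1(u;a)\,R(u-v).$$ Moreover, it satisfies the symmetry relation $$K^t(u;a)=K(\kappa-u;a)+\frac{K(u;a)-K(\kappa-u;a)}{2u-\kappa}+\frac{\mathrm{tr}(\mathcal G(u))\,K(\kappa-u;a)-\mathrm{tr}(K(u;a))\cdot I}{2u-2\kappa}.$$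
   Context: Rows and columns of $N\times N$ matrices are indexed by $\mathcal I_N=\{-n,\dots,-1,(0),1,\dots,n\}$ ($0$ omitted if $N=2n$); $E_{ij}$ are the elementary matrices; $(E_{ij})^t=E_{-j,-i}$. $P=\sum_{i,j}E_{ij}\otimes E_{ji}$, $Q=P^{t_1}=\sum_{i,j}E_{-j,-i}\otimes E_{ji}$, $\kappa=N/2-1$, and $R(u)=I-u^{-1}P+(u-\kappa)^{-1}Q\in\mathrm{End}(\mathbb C^N\otimes\mathbb C^N)(u)$. For a matrix $K$, $K_1=K\otimes I$, $K_2=I\otimes K$. The matrix $\mathcal G$ for the pair $(\mathfrak{so}_N,\mathfrak{so}_{N-2}\oplus\mathfrak{so}_2)$ is $\mathcal G=I-2E_{nn}-2E_{-n,-n}$, and $\mathcal G(u)=\frac{dI-u\mathcal G}{d-u}$. *)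

(* Defs.v *)
From HB Require Import structures.
From mathcomp Require Import all_boot all_order all_algebra.
From mathcomp Require Import fraction.
From mathcomp Require Import complex mxtens.
From mathcomp Require Import reals.

Set Implicit Arguments.
Unset Strict Implicit.
Unset Printing Implicit Defensive.

Import GRing.Theory.
Local Open Scope ring_scope.

(* The index set {-n, .., -1, (0), 1, .., n} (with n = N./2, and 0 omitted when
   N is even) is identified with 'I_N by the increasing bijection.  Under it
   i |-> -i is rev_ord, and for N > 0 the labels -n and n are ord0 and ord_max.
   End(C^N (x) C^N) is 'M_(N * N), with the Kronecker product *t of mxtens.

   All matrices are defined over an arbitrary field F.  Rational functions are
   obtained by taking for F a field of rational functions over C, and for the
   spectral parameter u : F a non-constant element of it (such as u - v, u + v
   or kappa - u), so that none of the denominators below vanishes. *)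

(* (E_{ij})^t = E_{-j,-i}, extended linearly (see ttr_delta). *)
Definition ttr (F : pzRingType) (N : nat) (A : 'M[F]_N) : 'M[F]_N :=
  \matrix_(i, j) A (rev_ord j) (rev_ord i).

Lemma ttr_delta (F : pzRingType) (N : nat) (i j : 'I_N) :
  ttr (delta_mx i j : 'M[F]_N) = delta_mx (rev_ord j) (rev_ord i).
Proof.
apply/matrixP => k l; rewrite !mxE.
by rewrite (inv_eq rev_ordK l) (inv_eq rev_ordK k) andbC.
Qed.

Section Matrices.

Variables (F : fieldType) (N : nat).

Definition kappa : F := N%:R / 2%:R - 1.

Definition dpar : F := N%:R / 4%:R - 1.

Definition Pmx : 'M[F]_(N * N) :=
  \sum_(i < N) \sum_(j < N) delta_mx i j *t delta_mx j i.

Definition Qmx : 'M[F]_(N * N) :=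
  \sum_(i < N) \sum_(j < N)
    delta_mx (rev_ord j) (rev_ord i) *t delta_mx j i.

Definition Rmx (u : F) : 'M[F]_(N * N) :=
  1%:M - u^-1 *: Pmx + (u - kappa)^-1 *: Qmx.

Definition leg1 (K : 'M[F]_N) : 'M[F]_(N * N) := K *t 1%:M.

Definition leg2 (K : 'M[F]_N) : 'M[F]_(N * N) := 1%:M *t K.

End Matrices.

Arguments kappa : clear implicits.
Arguments dpar : clear implicits.

Section KMatrices.

Variables (F : fieldType) (m : nat).

Local Notation N := m.+1.
Local Notation d := (dpar F N).
Local Notation Enn := (delta_mx ord_max ord_max : 'M[F]_N).
Local Notation Emm := (delta_mx ord0 ord0 : 'M[F]_N). (* E_{-n,-n} *)

Definition Gmx : 'M[F]_N := 1%:M - 2%:R *: Enn - 2%:R *: Emm.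

Definition Gmxu (u : F) : 'M[F]_N := (d - u)^-1 *: (d%:M - u *: Gmx).

Definition kfun (a u : F) : F :=
  (u - a) * (u + a - 2%:R * d) / (u - d) ^+ 2.

Definition Kmx (a u : F) : 'M[F]_N :=
  kfun a u *: (1%:M - (2%:R * u / (u - a)) *: Emm
                    - (2%:R * u / (u + a - 2%:R * d)) *: Enn).

End KMatrices.

Definition reflection_equation (F : fieldType) (N : nat)
    (K : F -> 'M[F]_N) (u v : F) : Prop :=
  Rmx N (u - v) *m leg1 (K u) *m Rmx N (u + v) *m leg2 (K v) =
  leg2 (K v) *m Rmx N (u + v) *m leg1 (K u) *m Rmx N (u - v).

Definition symmetry_relation (F : fieldType) (m : nat)
    (K : F -> 'M[F]_m.+1) (u : F) : Prop :=
  let kap := kappa F m.+1 in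
  ttr (K u) =
    K (kap - u)
    + (2%:R * u - kap)^-1 *: (K u - K (kap - u))
    + (2%:R * u - 2%:R * kap)^-1 *:
        (\tr (Gmxu m u) *: K (kap - u) - (\tr (K u))%:M).

(* C(u), with its variable and its constants. *)
Definition ratfun1 (C : fieldType) : fieldType := {fraction {poly C}}.
Definition var1 (C : fieldType) : ratfun1 C := FracField.tofrac 'X.
Definition const1 (C : fieldType) (a : C) : ratfun1 C := FracField.tofrac a%:P.

(* C(u, v) is the fraction field of C[u][v]. *)
Definition ratfun2 (C : fieldType) : fieldType := {fraction {poly {poly C}}}.
Definition varu (C : fieldType) : ratfun2 C := FracField.tofrac ('X)%:P.
Definition varv (C : fieldType) : ratfun2 C := FracField.tofrac 'X.
Definition const2 (C : fieldType) (a : C) : ratfun2 C :=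
  FracField.tofrac a%:P%:P.

(* Main.v *)
Require Import Defs.
From mathcomp Require Import all_boot all_order all_algebra.
From mathcomp Require Import fraction ring.
From mathcomp Require Import complex mxtens reals.

Set Implicit Arguments.
Unset Strict Implicit.
Unset Printing Implicit Defensive.

Import GRing.Theory Num.Theory.
Local Open Scope ring_scope.

(* K(u) is diagonal.  With A = K(u), B = K(v), and using PP = 1, PQ = QP = Q,
   P A_1 = A_2 P and Q A_1 Q = tr(A) Q, the product R(u-v) A_1 R(u+v) B_2
   expands into nine terms, each of the form X, X P Y or X Q Y with X, Y diagonal.
   The other side of the reflection equation is its transpose, so one compares
   the entries ((i,j),(k,l)) and ((k,l),(i,j)).  Up to the scalar (u-d)^-2, the
   diagonal of K takes three polynomial values, and with N = 4d+4,
   kappa = 2d+1 each entry becomes an identity between rational functions in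
   a, u, v, d.  The P- and Q-contributions to the entry (e_n (x) e_{-n},
   e_{-n} (x) e_n) vanish only together. *)

(** * Relations between P, Q and diagonal operators on the tensor square *)

Lemma sum_mxtens_index (V : nmodType) (m n : nat) (f : 'I_(m * n) -> V) :
  \sum_s f s = \sum_i \sum_j f (mxtens_index (i, j)).
Proof.
rewrite pair_big /= (reindex (@mxtens_index m n)) /=; first by apply: eq_bigr => -[].
by exists (@mxtens_unindex m n) => s _; rewrite ?mxtens_indexK ?mxtens_unindexK.
Qed.

Section TensorSquare.

Variables (F : fieldType) (N : nat).

Local Notation P := (Pmx F N).
Local Notation Q := (Qmx F N).
Local Notation idx i j := (mxtens_index (i, j)).

Lemma PmxE i j k l : P (idx i j) (idx k l) = ((i == l) && (j == k))%:R.
Proof.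
rewrite /Pmx summxE (bigD1 i) //= summxE (bigD1 j) //=.
rewrite tensmxE !mxE !eqxx /= big1 => [|j' /negPf nj]; last first.
  by rewrite tensmxE !mxE eqxx (eq_sym j) nj mulr0.
rewrite big1 => [|i' /negPf ni]; last first.
  by rewrite summxE big1 // => j' _; rewrite tensmxE !mxE (eq_sym i) ni mul0r.
by rewrite !addr0 -natrM mulnb [k == j]eq_sym [l == i]eq_sym andbC.
Qed.

(** This form exhibits Q as the rank-one matrix $w w^T$ with $w=\sum_i e_i\otimes e_{-i}$, the
    source of every relation for Q below. *)
Lemma QmxE i j k l :
  Q (idx i j) (idx k l) = ((j == rev_ord i) && (l == rev_ord k))%:R.
Proof.
rewrite /Qmx summxE (bigD1 l) //= summxE (bigD1 j) //=.
rewrite tensmxE !mxE !eqxx /= big1 => [|j' /negPf nj]; last first.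
  by rewrite tensmxE !mxE (eq_sym j) nj mulr0.
rewrite big1 => [|l' /negPf nl]; last first.
  by rewrite summxE big1 // => j' _; rewrite tensmxE !mxE (eq_sym l) nl andbF mulr0.
by rewrite !addr0 mulr1; congr (_ && _)%:R; rewrite eq_sym (inv_eq rev_ordK).
Qed.

(** Diagonal operators are encoded by the eigenvalue on $e_i\otimes e_j$ as a function of two
    labels, so that conjugation by P just swaps the arguments. *)
Definition tdiag (f : 'I_N -> 'I_N -> F) : 'M[F]_(N * N) :=
  diag_mx (\row_s f (mxtens_unindex s).1 (mxtens_unindex s).2).

Lemma mul_tdiag_mxE f (M : 'M_(N * N)) i j s :
  (tdiag f *m M) (idx i j) s = f i j * M (idx i j) s.
Proof. by rewrite mul_diag_mx !mxE mxtens_indexK. Qed.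

Lemma mul_mx_tdiagE f (M : 'M_(N * N)) s k l :
  (M *m tdiag f) s (idx k l) = M s (idx k l) * f k l.
Proof. by rewrite mul_mx_diag !mxE mxtens_indexK. Qed.

Lemma tdiagE f i j k l :
  tdiag f (idx i j) (idx k l) = f i j *+ ((i == k) && (j == l)).
Proof.
rewrite !mxE mxtens_indexK /= (can_eq (@mxtens_indexK N N)).
by rewrite xpair_eqE.
Qed.

Lemma tensmx_diag (a b : 'rV[F]_N) :
  diag_mx a *t diag_mx b = tdiag (fun i j => a 0 i * b 0 j).
Proof.
apply/matrixP=> s t; case: (mxtens_indexP s) => i j; case: (mxtens_indexP t) => k l.
by rewrite tensmxE tdiagE !mxE mulrnAl mulrnAr -mulrnA mulnb andbC.
Qed.

Lemma mul_Pmx_tdiag f : P *m tdiag f = tdiag (fun i j => f j i) *m P.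
Proof.
apply/matrixP=> s t; case: (mxtens_indexP s) => i j; case: (mxtens_indexP t) => k l.
rewrite mul_mx_tdiagE mul_tdiag_mxE PmxE.
case: (i =P l) => [->|_] /=; last by rewrite mulr0 mul0r.
by case: (j =P k) => [->|_] /=; rewrite ?mulr0 ?mul0r // mulrC.
Qed.

Lemma mul_PmxE (M : 'M_(N * N)) i j t : (P *m M) (idx i j) t = M (idx j i) t.
Proof.
rewrite mxE sum_mxtens_index (bigD1 j) //= (bigD1 i) //= PmxE !eqxx mul1r.
rewrite big1 => [|k /negPf nk]; last by rewrite PmxE eq_sym nk mul0r.
rewrite big1 => [|k /negPf nk]; first by rewrite !addr0.
by rewrite big1 // => l _; rewrite PmxE [j == k]eq_sym nk andbF mul0r.
Qed.

Lemma Pmx_invol : P *m P = 1%:M.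
Proof.
apply/matrixP=> s t; case: (mxtens_indexP s) => i j; case: (mxtens_indexP t) => k l.
rewrite mul_PmxE PmxE !mxE (can_eq (@mxtens_indexK N N)) xpair_eqE.
by rewrite andbC.
Qed.

Lemma trPmx : P^T = P.
Proof.
apply/matrixP=> s t; case: (mxtens_indexP s) => i j; case: (mxtens_indexP t) => k l.
by rewrite mxE !PmxE andbC ![_ == i]eq_sym ![_ == j]eq_sym.
Qed.

Lemma trQmx : Q^T = Q.
Proof.
apply/matrixP=> s t; case: (mxtens_indexP s) => i j; case: (mxtens_indexP t) => k l.
by rewrite mxE !QmxE andbC.
Qed.

(** The flip fixes the vector $w$ that spans the image of Q. *)
Lemma mul_Pmx_Qmx : P *m Q = Q.
Proof.
apply/matrixP=> s t; case: (mxtens_indexP s) => i j; case: (mxtens_indexP t) => k l.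
by rewrite mul_PmxE !QmxE [j == _]eq_sym (inv_eq rev_ordK).
Qed.

Lemma mul_Qmx_Pmx : Q *m P = Q.
Proof. by rewrite -[LHS]trmxK trmx_mul trPmx trQmx mul_Pmx_Qmx trQmx. Qed.

(** Since $Q=ww^T$, the middle of the product collapses to the scalar $w^T D w$, where D is
    [tdiag f]. *)
Lemma mul_Qmx_tdiag_Qmx f :
  Q *m tdiag f *m Q = (\sum_i f i (rev_ord i)) *: Q.
Proof.
apply/matrixP=> s t; case: (mxtens_indexP s) => i j; case: (mxtens_indexP t) => k l.
rewrite 2!mxE sum_mxtens_index mulr_suml; apply: eq_bigr => i' _.
rewrite (bigD1 (rev_ord i')) //= big1 => [|j' /negPf nj]; last first.
  by rewrite mul_mx_tdiagE !QmxE nj mulr0.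
rewrite addr0 mul_mx_tdiagE !QmxE eqxx andbT.
by case: (j == _) => /=; rewrite ?mul1r ?mul0r ?mulr0.
Qed.

Lemma reflection_expand (al be ga de : F) f g :
  let X := tdiag f in let Y := tdiag g in
  let X' := tdiag (fun i j => f j i) in
  let t := \sum_i f i (rev_ord i) in
  (1%:M - al *: P + be *: Q) *m X *m (1%:M - ga *: P + de *: Q) *m Y =
  X *m Y - ga *: (X *m P *m Y) + de *: (X *m Q *m Y)
  - al *: (X' *m P *m Y) + (al * ga) *: (X' *m Y)
  - (al * de) *: (X' *m Q *m Y)
  + be *: (Q *m X *m Y) - (be * ga) *: (Q *m X' *m Y)
  + (be * de * t) *: (Q *m Y).
Proof.
move=> X Y X' t.
have PX : P *m X = X' *m P := mul_Pmx_tdiag f.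
have XP : X *m P = P *m X' by rewrite mul_Pmx_tdiag.
have QXQ : Q *m X *m Q = t *: Q := mul_Qmx_tdiag_Qmx f.
have -> : (1%:M - al *: P + be *: Q) *m X = X - al *: (X' *m P) + be *: (Q *m X).
  by rewrite mulmxDl mulmxBl mul1mx -!scalemxAl PX.
have -> : (X - al *: (X' *m P) + be *: (Q *m X)) *m (1%:M - ga *: P + de *: Q) =
  X - ga *: (X *m P) + de *: (X *m Q)
  - al *: (X' *m P) + (al * ga) *: X' - (al * de) *: (X' *m Q)
  + be *: (Q *m X) - (be * ga) *: (Q *m X') + (be * de * t) *: Q.
  rewrite !mulmxDl !mulmxDr !mulmxN !mulNmx !mulmx1 -!scalemxAl -!scalemxAr.
  rewrite -[X' *m P *m P]mulmxA Pmx_invol mulmx1.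
  rewrite -[X' *m P *m Q]mulmxA mul_Pmx_Qmx.
  (* P is moved left past X, where Q absorbs it: $QXP=QPX'=QX'$. *)
  rewrite -[Q *m X *m P]mulmxA XP mulmxA mul_Qmx_Pmx QXQ.
  by rewrite !scalerA !opprK !addrA.
by rewrite !(mulmxDl, mulNmx) -!scalemxAl.
Qed.

End TensorSquare.

(** * The diagonal of K(u) and the resulting scalar identities *)

Lemma rev_ord0 (m : nat) : rev_ord ord0 = ord_max :> 'I_m.+1.
Proof. by apply: val_inj; rewrite /= subn1. Qed.

Lemma rev_ord_max (m : nat) : rev_ord ord_max = ord0 :> 'I_m.+1.
Proof. by rewrite -rev_ord0 rev_ordK. Qed.

Section DiagonalK.

Variables (F : fieldType) (m : nat).

Local Notation N := m.+1.
Local Notation d := (dpar F N).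

(** The diagonal of $(u-d)^2K(u;a)$. With its denominators cleared, only those of R enter the
    reflection identities. *)
Definition kpoly (a u : F) (i : 'I_N) : F :=
  if i == ord0 then - (u + a) * (u + a - 2%:R * d)
  else if i == ord_max then - (u - a) * (u - a + 2%:R * d)
  else (u - a) * (u + a - 2%:R * d).

Lemma Kmx_kpoly (a u : F) : u - a != 0 -> u + a - 2%:R * d != 0 -> u - d != 0 ->
    (0 < m)%N ->
  Kmx m a u = (u - d) ^- 2 *: diag_mx (\row_i kpoly a u i).
Proof.
move=> ua uad ud m0; apply/matrixP=> i j; rewrite !mxE /kfun /kpoly.
(* The labels $n$ and $-n$ are distinct, so the two corrections to the identity do not overlap. *)
have ne : ord_max != ord0 :> 'I_N by rewrite -val_eqE /= -lt0n.
have [<-|nij] := eqVneq i j; last first.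
  have nE c : (i == c) && (j == c) = false.
    by apply: contraNF nij => /andP[/eqP-> /eqP->].
  by rewrite !nE /= !mulr0 !subr0 !mulr0.
rewrite !andbb /=.
have [->|_] := eqVneq i ord0; first by rewrite eq_sym (negPf ne) /=; field; rewrite ud uad ua.
by case: (i == ord_max) => /=; field; rewrite ud uad ua.
Qed.

Hypothesis four_neq0 : 4%:R != 0 :> F.

Lemma two_neq0 : 2%:R != 0 :> F.
Proof. by apply: contra_neq four_neq0 => e; rewrite (natrM _ 2 2) e mul0r. Qed.

Lemma natr_dpar : N%:R = 4%:R * d + 4%:R.
Proof. by rewrite /dpar mulrBr mulrCA divff // !mulr1 subrK. Qed.

Lemma kappa_dpar : kappa F N = 2%:R * d + 1.
Proof. rewrite /kappa /dpar; field; rewrite ?four_neq0 ?two_neq0 //. Qed.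

Lemma sum_kpoly (a u : F) : (0 < m)%N ->
  \sum_i kpoly a u i = - (u + a) * (u + a - 2%:R * d)
     - (u - a) * (u - a + 2%:R * d)
     + (4%:R * d + 2%:R) * ((u - a) * (u + a - 2%:R * d)).
Proof.
move=> m0; have ne : ord_max != ord0 :> 'I_N by rewrite -val_eqE /= -lt0n.
rewrite (bigD1 ord0) //= (bigD1 ord_max) //= {1 2}/kpoly eqxx (negPf ne) eqxx.
rewrite addrA !mulNr; congr (_ + _).
rewrite (eq_bigr (fun=> (u - a) * (u + a - 2%:R * d))); last first.
  by move=> i /andP[/negPf i0 /negPf i1]; rewrite /kpoly i0 i1.
rewrite sumr_const -[LHS]mulr_natl; congr (_ * _).
(* There are $N-2$ ordinary labels, counted additively to avoid truncated subtraction; in F this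
   number is $4d+2$. *)
have E : (#|[pred i : 'I_N | (i != ord0) && (i != ord_max)]| + 2 = N)%N.
  have := cardC (pred2 (ord0 : 'I_N) ord_max).
  rewrite card_ord card2 eq_sym ne addnC => E; rewrite -[RHS]E.
  by congr (_ + _)%N; apply: eq_card => i; rewrite !inE negb_or.
apply: (@addIr _ 2%:R); rewrite -natrD E natr_dpar. ring.
Qed.

Lemma kpoly_rev (a u : F) (i : 'I_N) : (0 < m)%N ->
  kpoly a u (rev_ord i) =
    if i == ord0 then - (u - a) * (u - a + 2%:R * d)
    else if i == ord_max then - (u + a) * (u + a - 2%:R * d)
    else (u - a) * (u + a - 2%:R * d).
Proof.
move=> m0; have ne : ord_max != ord0 :> 'I_N by rewrite -val_eqE /= -lt0n.
rewrite /kpoly !(inv_eq rev_ordK) rev_ord0 rev_ord_max.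
by case: (i =P ord0) => [->|//]; rewrite eq_sym (negPf ne).
Qed.

Lemma kpoly_reflection (a u v : F) :
    (0 < m)%N -> u - v != 0 -> u + v != 0 ->
    u - v - kappa F N != 0 -> u + v - kappa F N != 0 ->
  let A := diag_mx (\row_i kpoly a u i) in
  let B := diag_mx (\row_i kpoly a v i) in
  let M := Rmx N (u - v) *m leg1 A *m Rmx N (u + v) *m leg2 B in M^T = M.
Proof.
move=> m0 uv0 uv1 uv2 uv3.
rewrite /leg1 /leg2 -!diag_const_mx !tensmx_diag.
move: uv2 uv3; rewrite /Rmx kappa_dpar => uv2 uv3; rewrite reflection_expand.
apply/matrixP=> s t; case: (mxtens_indexP s) => i j; case: (mxtens_indexP t) => k l.
have addE (A B : 'M[F]_(N * N)) x y : (A + B) x y = A x y + B x y by rewrite mxE.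
have oppE (A : 'M[F]_(N * N)) x y : (- A) x y = - A x y by rewrite mxE.
have sclE c (A : 'M[F]_(N * N)) x y : (c *: A) x y = c * A x y by rewrite mxE.
rewrite [LHS]mxE !(addE, oppE, sclE, mul_mx_tdiagE, mul_tdiag_mxE).
rewrite !(tdiagE, PmxE, QmxE) !mxE.
under eq_bigr do rewrite !mxE mulr1.
rewrite sum_kpoly // !mulr1 !mul1r [i == k]eq_sym [j == l]eq_sym.
rewrite [i == l]eq_sym [j == k]eq_sym [(l == i) && _]andbC.
rewrite [(j == rev_ord i) && _]andbC.
(* Diagonal entries are fixed by transposition; away from them the terms $XY$ and $X'Y$ vanish. *)
have [/andP[/eqP-> /eqP->]//|nd] := boolP ((k == i) && (l == j)).
rewrite !mulr0n !mul0r !mulr0 !addr0 !add0r.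
have [/andP[/eqP ek /eqP el]|np] := boolP ((k == j) && (l == i)).
  rewrite {}ek {}el [i == rev_ord j]eq_sym (inv_eq rev_ordK) andbb.
  (* For $j=-i$ the entry at the position of P also receives every Q-term, including the trace term,
     so one identity with all four denominators is checked. *)
  have [->|nq] := eqVneq j (rev_ord i) => /=; rewrite ?mulr1 ?mul1r.
    rewrite !kpoly_rev // /kpoly.
    case: (i == ord0); last case: (i == ord_max);
    (field; rewrite ?uv0 ?uv1 ?uv2 ?uv3 //).
  rewrite !mulr0 !mul0r !mulr0 !addr0 !subr0.
  (* The pairs $(-n,n)$ and $(n,-n)$ must be excluded: there the P-terms alone do not cancel. *)
  have jm : ~~ ((i == ord0) && (j == ord_max)).
    by apply: contra nq => /andP[/eqP-> /eqP->]; rewrite rev_ord0.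
  have jn : ~~ ((i == ord_max) && (j == ord0)).
    by apply: contra nq => /andP[/eqP-> /eqP->]; rewrite rev_ord_max.
  rewrite /kpoly; move: jm jn.
  case: (i == ord0); case: (j == ord0); case: (i == ord_max);
    case: (j == ord_max) => //= _ _; (field; rewrite ?uv0 ?uv1 //).
rewrite /= !(mulr0, mul0r, oppr0, addr0, add0r).
(* Only Q can still contribute, which forces $j=-i$ and $l=-k$; $k=-i$ would return to the position
   of P. *)
have [/andP[/eqP el /eqP ej]|_] := boolP ((l == rev_ord k) && (j == rev_ord i)); last first.
  by rewrite /= !(mulr0, mul0r).
have nki : k != rev_ord i.
  by apply: contra np => /eqP ek; rewrite ej el ek rev_ordK !eqxx.
have nk : ~~ ((i == ord0) && (k == ord_max)).
  by apply: contra nki => /andP[/eqP-> /eqP->]; rewrite rev_ord0.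
have nk' : ~~ ((i == ord_max) && (k == ord0)).
  by apply: contra nki => /andP[/eqP-> /eqP->]; rewrite rev_ord_max.
rewrite /= !mulr1 !mul1r el ej !kpoly_rev // /kpoly; move: nk nk'.
case: (i == ord0); case: (k == ord0); case: (i == ord_max);
  case: (k == ord_max) => //= _ _; (field; rewrite ?uv0 ?uv1 ?uv2 ?uv3 //).
Qed.

Lemma Kmx_reflection (a u v : F) :
    (0 < m)%N ->
    u - a != 0 -> u + a - 2%:R * d != 0 -> u - d != 0 ->
    v - a != 0 -> v + a - 2%:R * d != 0 -> v - d != 0 ->
    u - v != 0 -> u + v != 0 ->
    u - v - kappa F N != 0 -> u + v - kappa F N != 0 ->
  reflection_equation (Kmx m a) u v.
Proof.
move=> m0 ua ua' ud va va' vd uv0 uv1 uv2 uv3; rewrite /reflection_equation.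
rewrite !Kmx_kpoly //.
have := kpoly_reflection a m0 uv0 uv1 uv2 uv3.
set A := diag_mx _; set B := diag_mx _ => /= M.
have E1 c (X : 'M[F]_N) : leg1 (c *: X) = c *: leg1 X.
  apply/matrixP=> s t; case: (mxtens_indexP s) => i j.
  by case: (mxtens_indexP t) => k l; rewrite /leg1 /leg2 [RHS]mxE !tensmxE mxE mulrA.
have E2 c (X : 'M[F]_N) : leg2 (c *: X) = c *: leg2 X.
  apply/matrixP=> s t; case: (mxtens_indexP s) => i j.
  by case: (mxtens_indexP t) => k l; rewrite /leg1 /leg2 [RHS]mxE !tensmxE !mxE mulrCA.
have trR x : (Rmx N x)^T = Rmx N x.
  by rewrite /Rmx !linearD linearN !linearZ /= trPmx trQmx trmx1.
rewrite E1 E2 -!(scalemxAr, scalemxAl) !scalerA; congr (_ *: _).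
(* All four factors are symmetric, so transposing the left side reverses their order and yields the
   right side. *)
rewrite -M !trmx_mul !trR /leg1 /leg2 !trmx_tens !tr_diag_mx trmx1.
by rewrite !mulmxA.
Qed.

(** Both sides are diagonal and [ttr] merely swaps the entries at $-n$ and $n$. Once the traces are
    written in terms of $d$, three scalar identities remain. *)
Lemma Kmx_symmetry (a u : F) :
    (0 < m)%N -> let w := kappa F N - u in
    u - a != 0 -> u + a - 2%:R * d != 0 -> u - d != 0 ->
    w - a != 0 -> w + a - 2%:R * d != 0 -> w - d != 0 ->
    2%:R * u - kappa F N != 0 -> 2%:R * u - 2%:R * kappa F N != 0 ->
  symmetry_relation (Kmx m a) u.
Proof.
move=> m0 w ua ua' ud wa wa' wd u1 u2; rewrite /symmetry_relation.
rewrite -/w !Kmx_kpoly // (mxtraceZ _ (diag_mx _)) mxtrace_diag.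
under eq_bigr do rewrite mxE.
rewrite sum_kpoly //.
(* Here $\mathrm{tr}\,\mathcal G=N-4=4d$, so the numerator is $Nd-4du$ with $N=4d+4$. *)
have -> : \tr (Gmxu m u) = d * (4%:R - 4%:R * u + 4%:R * d) / (d - u).
  have trE i : \tr (delta_mx i i : 'M[F]_N) = 1.
    rewrite /mxtrace (bigD1 i) //= mxE eqxx big1 ?addr0 // => j /negPf ji.
    by rewrite mxE ji.
  rewrite /Gmxu mxtraceZ raddfB /= mxtraceZ.
  have -> : \tr (Gmx F m) = N%:R - 4%:R.
    by rewrite /Gmx !raddfB /= !mxtraceZ !trE mxtrace1; ring.
  rewrite mxtrace_scalar -(mulr_natl d) natr_dpar; field.
  by rewrite subr_eq0 eq_sym -subr_eq0.
have du : d - u != 0 by rewrite subr_eq0 eq_sym -subr_eq0.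
move: wd u1 u2; rewrite /w kappa_dpar => wd u1 u2.
apply/matrixP=> i j; rewrite !mxE (inj_eq rev_ord_inj).
have [<-|nij] := eqVneq i j; last first.
  by rewrite /= !(mulr0n, mulr0, addr0, subr0).
rewrite /= ?mulr1n kpoly_rev // /kpoly.
case: (i == ord0); last case: (i == ord_max).
all: by field; rewrite wd ud du u1 u2.
Qed.

End DiagonalK.

(** * Passage to generic spectral parameters *)

Section Specialization.

Variables (C F : fieldType) (f : {rmorphism C -> F}) (m : nat) (a : C).
Hypotheses (four_neq0 : 4%:R != 0 :> C) (m0 : (0 < m)%N).

Local Notation N := m.+1.
Local Notation d := (dpar C N).

Lemma rmorph_dpar : dpar F N = f d.
Proof. by rewrite /dpar rmorphB fmorph_div !rmorph_nat rmorph1. Qed.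

Lemma rmorph_four_neq0 : 4%:R != 0 :> F.
Proof. by rewrite -(rmorph_nat f) fmorph_eq0. Qed.

Lemma rmorph_kappa : kappa F N = f (kappa C N).
Proof. by rewrite /kappa rmorphB fmorph_div !rmorph_nat rmorph1. Qed.

(** Every denominator is a nonconstant affine form in $u,v$ with coefficients from C, so a single
    independence hypothesis covers them all. *)
Lemma Kmx_reflection_affine_indep (u v : F) :
    (forall x y z, (x != 0) || (y != 0) -> f x * u + f y * v + f z != 0) ->
  reflection_equation (Kmx m (f a)) u v.
Proof.
move=> nz; apply: (Kmx_reflection rmorph_four_neq0 m0); rewrite ?rmorph_dpar ?rmorph_kappa.
- rewrite (_ : _ - _ = f 1 * u + f 0 * v + f (- a)) ?nz ?oner_eq0 //; ring.
- rewrite (_ : _ - _ = f 1 * u + f 0 * v + f (a - 2%:R * d)) ?nz ?oner_eq0 //; ring.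
- rewrite (_ : _ - _ = f 1 * u + f 0 * v + f (- d)) ?nz ?oner_eq0 //; ring.
- rewrite (_ : _ - _ = f 0 * u + f 1 * v + f (- a)) ?nz ?oner_eq0 ?orbT //; ring.
- rewrite (_ : _ - _ = f 0 * u + f 1 * v + f (a - 2%:R * d)) ?nz ?oner_eq0 ?orbT //; ring.
- rewrite (_ : _ - _ = f 0 * u + f 1 * v + f (- d)) ?nz ?oner_eq0 ?orbT //; ring.
- rewrite (_ : _ - _ = f 1 * u + f (- 1) * v + f 0) ?nz ?oner_eq0 //; ring.
- rewrite (_ : _ + _ = f 1 * u + f 1 * v + f 0) ?nz ?oner_eq0 //; ring.
- rewrite (_ : _ - _ = f 1 * u + f (- 1) * v + f (- kappa C N)) ?nz ?oner_eq0 //; ring.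
- rewrite (_ : _ - _ = f 1 * u + f 1 * v + f (- kappa C N)) ?nz ?oner_eq0 //; ring.
Qed.

Lemma Kmx_symmetry_affine_indep (u : F) :
    (forall x y, x != 0 -> f x * u + f y != 0) ->
  symmetry_relation (Kmx m (f a)) u.
Proof.
move=> nz; have n2 := two_neq0 four_neq0.
have nN1 : - 1 != 0 :> C by rewrite oppr_eq0 oner_eq0.
apply: (Kmx_symmetry rmorph_four_neq0 m0); rewrite ?rmorph_dpar ?rmorph_kappa.
- rewrite (_ : _ - _ = f 1 * u + f (- a)) ?nz ?oner_eq0 //; ring.
- rewrite (_ : _ - _ = f 1 * u + f (a - 2%:R * d)) ?nz ?oner_eq0 //; ring.
- rewrite (_ : _ - _ = f 1 * u + f (- d)) ?nz ?oner_eq0 //; ring.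
- rewrite (_ : _ - _ = f (- 1) * u + f (kappa C N - a)) ?nz //; ring.
- rewrite (_ : _ - _ = f (- 1) * u + f (kappa C N + a - 2%:R * d)) ?nz //; ring.
- rewrite (_ : _ - _ = f (- 1) * u + f (kappa C N - d)) ?nz //; ring.
- rewrite (_ : _ - _ = f 2%:R * u + f (- kappa C N)) ?nz //; ring.
- rewrite (_ : _ - _ = f 2%:R * u + f (- (2%:R * kappa C N))) ?nz //; ring.
Qed.

End Specialization.

Lemma var1_affine_neq0 (C : fieldType) (x y : C) :
  x != 0 -> const1 x * var1 C + const1 y != 0.
Proof.
move=> x0; rewrite /const1 /var1 -tofracM -tofracD tofrac_eq0.
apply: contraNneq x0 => /(congr1 (coefp 1)) /=.
by rewrite coefD coefMX !coefC addr0 => ->.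
Qed.

Lemma varuv_affine_neq0 (C : fieldType) (x y z : C) :
  (x != 0) || (y != 0) -> const2 x * varu C + const2 y * varv C + const2 z != 0.
Proof.
move=> xy; rewrite /const2 /varu /varv -!tofracM -!tofracD tofrac_eq0.
apply: contraTneq xy => e; rewrite negb_or !negbK.
(* In $C[u][v]$ the outer variable is $v$: the coefficient of $u$ is [p_0_1] and that of $v$ is
   [p_1_0], with the outer index first. *)
have := congr1 (fun p : {poly {poly C}} => p`_0`_1) e.
have := congr1 (fun p : {poly {poly C}} => p`_1`_0) e.
rewrite /= -!polyCM !(coefD, coefC, coefMX) /= !(addr0, add0r).
by move=> -> ->; rewrite eqxx.
Qed.

(* N = m.+1. *)
Theorem lemma5p4 (R : realType) (m : nat) (hN : (5 <= m.+1)%N) (a : R[i]) :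
  reflection_equation (Kmx m (const2 a)) (varu R[i]) (varv R[i]) /\
  symmetry_relation (Kmx m (const1 a)) (var1 R[i]).
Proof.
have four_neq0 : 4%:R != 0 :> R[i] by rewrite pnatr_eq0.
have m0 : (0 < m)%N by case: m hN.
split.
(* The constants embed by two nested constant-polynomial maps followed by [tofrac], a morphism that
   unfolds to [const2]. *)
- apply: (@Kmx_reflection_affine_indep R[i] (ratfun2 R[i])
    (@FracField.tofrac {poly {poly R[i]}} \o polyC \o polyC)) => //.
  exact: varuv_affine_neq0.
- apply: (@Kmx_symmetry_affine_indep R[i] (ratfun1 R[i])
    (@FracField.tofrac {poly R[i]} \o polyC)) => //.
  exact: var1_affine_neq0.
Qed.
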